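(* $$\int_0^\infty \frac{x\sin ax}{\cosh^2 x}\,dx=\frac{\pi}{4}\left[-2+a\pi\coth\!\left(\frac{\pi a}{2}\right)\right]\operatorname{csch}\!\left(\frac{a\pi}{2}\right)=-\frac{d}{da}\,\frac{\pi a}{2\sinh(\pi a/2)}.$$ *)

(* Defs.v *)
From Stdlib Require Import Reals.
From Coquelicot Require Import Coquelicot.
Open Scope R_scope.

(* Both are meaningful only for [x <> 0], where [sinh x <> 0]. *)
Definition coth (x : R) : R := cosh x / sinh x.
Definition csch (x : R) : R := 1 / sinh x.

(* Main.v *)
(** Expand [1 / cosh^2 x = -4 sum_k (-1)^k k exp (-2kx)] and integrate
    [x sin (a x)] termwise; cutting the series at [n] costs only [O(1/n)].
    With [s = sinh (a PI / 2)], the [k]-th integrated term is [-2] times the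
    cosine coefficient [int_0^(PI/2) h(t) cos (2kt) dt] of
    [h(t) = d/da (a cosh (a t) / s)].  Hence the partial sums are
    [- int h D_n], with [D_n] the Dirichlet kernel, and since
    [h(t) - h(0) = O(sin^2 t)] their Cesaro means, which involve the Fejer
    kernel, tend to [- h(0) PI / 2 = - d/da (PI a / (2 s))]. *)

Require Import Defs.
From Stdlib Require Import Reals.
From Stdlib Require Import Lra Lia.
From Coquelicot Require Import Coquelicot.
Open Scope R_scope.

(** * Termwise integrals over [[0, B]] and their decay in [B] *)

Lemma is_RInt_sum_f_R0 (f : nat -> R -> R) (I : nat -> R) (a b : R) (n : nat) :
  (forall k, is_RInt (f k) a b (I k)) ->
  is_RInt (fun x => sum_f_R0 (fun k => f k x) n) a b (sum_f_R0 I n).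
Proof.
  intros H; induction n as [|n IH]; simpl.
  - apply H.
  - apply (is_RInt_plus (V := R_NormedModule)); auto.
Qed.

Lemma is_RInt_antiderivative (F f : R -> R) (a b : R) :
  (forall x, is_derive F x (f x)) -> (forall x, ex_derive f x) ->
  is_RInt f a b (F b - F a).
Proof.
  intros HF Hf.
  apply (is_RInt_derive (V := R_CompleteNormedModule) F f).
  - intros; apply HF.
  - intros; apply (ex_derive_continuous (V := R_NormedModule)); apply Hf.
Qed.

Lemma sinh_neq_0 (x : R) : x <> 0 -> sinh x <> 0.
Proof.
  intros Hx Hs.
  destruct (Rdichotomy _ _ Hx) as [H|H].
  - pose proof (sinh_lt _ _ H) as H1; rewrite sinh_0 in H1; lra.
  - pose proof (sinh_lt _ _ H) as H1; rewrite sinh_0 in H1; lra.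
Qed.

Lemma sum_sqr_neq_0 (a m : R) : a <> 0 -> a * a + m * m <> 0.
Proof. intros Ha; assert (0 < a * a) by nra; nra. Qed.

(* Imaginary part of [- (x / z + 1 / z^2) exp (- z x)] at [z = m - i a]. *)
Definition xsin_exp_primitive (a m x : R) : R :=
  exp (- (m * x)) *
  ((- m / (a * a + m * m) * x
      + (a * a - m * m) / (a * a + m * m) ^ 2) * sin (a * x)
   + (- a / (a * a + m * m) * x
      - 2 * a * m / (a * a + m * m) ^ 2) * cos (a * x)).

Lemma is_RInt_xsin_exp (a m u v : R) : a <> 0 ->
  is_RInt (fun x => x * sin (a * x) * exp (- (m * x))) u v
    (xsin_exp_primitive a m v - xsin_exp_primitive a m u).
Proof.
  intros Ha; apply is_RInt_antiderivative.
  - intros x; unfold xsin_exp_primitive; auto_derive; [trivial|].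
    pose proof (sum_sqr_neq_0 a m Ha); field; trivial.
  - intros x; auto_derive; trivial.
Qed.

Lemma xsin_exp_primitive_0 (a m : R) :
  xsin_exp_primitive a m 0 = - (2 * a * m / (a * a + m * m) ^ 2).
Proof.
  unfold xsin_exp_primitive.
  rewrite !Rmult_0_r, Ropp_0, exp_0, sin_0, cos_0; unfold Rdiv; ring.
Qed.

(** With [m = 2 (n + 1)] this integrates, up to a constant factor, the majorant of the remainder
    after cutting the series at [n]. *)
Lemma is_RInt_x_exp (m B : R) : 0 < m ->
  is_RInt (fun x => x * exp (- (m * x))) 0 B
    (1 / m ^ 2 - (B / m + 1 / m ^ 2) * exp (- (m * B))).
Proof.
  intros Hm.
  pose (F := fun x => - (x / m + 1 / m ^ 2) * exp (- (m * x))).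
  replace (1 / m ^ 2 - (B / m + 1 / m ^ 2) * exp (- (m * B))) with (F B - F 0).
  2:{ unfold F; rewrite !Rmult_0_r, Ropp_0, exp_0; field; lra. }
  apply is_RInt_antiderivative.
  - intros x; unfold F; auto_derive; [lra|]; field; lra.
  - intros x; auto_derive; trivial.
Qed.

(** Since [m >= 1], the case [m = 1] dominates. Squaring [1 + B/2 <= exp (B/2)] gives
    [exp (-B) (1 + B/2)^2 <= 1], and [(1 + B) B <= 4 (1 + B/2)^2]. *)
Lemma one_plus_mul_exp_opp_le (m B : R) : 1 <= m -> 0 < B ->
  (1 + B) * exp (- (m * B)) <= 4 / B.
Proof.
  intros Hm HB.
  assert (H1 : exp (- (m * B)) <= exp (- B)).
  { destruct (Req_dec m 1) as [->|Hm1]; [rewrite Rmult_1_l; lra|].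
    left; apply exp_increasing; nra. }
  assert (H2 : 1 + B / 2 <= exp (B / 2)) by (left; apply exp_ineq1; lra).
  assert (H3 : exp (- B) * (exp (B / 2) * exp (B / 2)) = 1).
  { rewrite <- !exp_plus, <- exp_0; f_equal; lra. }
  assert (H4 : (1 + B / 2) * (1 + B / 2) <= exp (B / 2) * exp (B / 2)) by nra.
  assert (H5 : 0 < exp (- B)) by apply exp_pos.
  apply Rmult_le_reg_r with B; [lra|].
  replace (4 / B * B) with 4 by (field; lra).
  assert (H6 : exp (- B) * ((1 + B / 2) * (1 + B / 2)) <= 1) by nra.
  assert (H7 : (1 + B) * exp (- (m * B)) * B <= (1 + B) * B * exp (- B)).
  { assert (0 < (1 + B) * B) by nra; nra. }
  assert (H8 : (1 + B) * B <= 4 * ((1 + B / 2) * (1 + B / 2))) by nra.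
  nra.
Qed.

Lemma xsin_exp_primitive_bound (a m : R) : 1 <= m ->
  exists c, forall B, 0 < B -> Rabs (xsin_exp_primitive a m B) <= c / B.
Proof.
  intros Hm; unfold xsin_exp_primitive.
  set (p := - m / (a * a + m * m)); set (q := (a * a - m * m) / (a * a + m * m) ^ 2).
  set (r := - a / (a * a + m * m)); set (s := 2 * a * m / (a * a + m * m) ^ 2).
  (* The linear factors are at most the sum of the coefficients times [1 + B]; the 4 is that of
     [one_plus_mul_exp_opp_le]. *)
  exists ((Rabs p + Rabs q + Rabs r + Rabs s) * 4); intros B HB.
  pose proof (one_plus_mul_exp_opp_le m B Hm HB) as HE.
  pose proof (exp_pos (- (m * B))) as He.
  assert (Hs : Rabs (sin (a * B)) <= 1) by (apply Rabs_le; apply SIN_bound).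
  assert (Hc : Rabs (cos (a * B)) <= 1) by (apply Rabs_le; apply COS_bound).
  pose proof (Rabs_pos p); pose proof (Rabs_pos q).
  pose proof (Rabs_pos r); pose proof (Rabs_pos s).
  assert (Hlin : forall u v, Rabs (u * B + v) <= (Rabs u + Rabs v) * (1 + B)).
  { intros u v; eapply Rle_trans; [apply Rabs_triang|].
    rewrite Rabs_mult, (Rabs_pos_eq B) by lra.
    pose proof (Rabs_pos u); pose proof (Rabs_pos v); nra. }
  assert (Hsum : Rabs ((p * B + q) * sin (a * B) + (r * B - s) * cos (a * B))
    <= (Rabs p + Rabs q + Rabs r + Rabs s) * (1 + B)).
  { eapply Rle_trans; [apply Rabs_triang|]; rewrite !Rabs_mult.
    pose proof (Hlin p q) as H3; pose proof (Hlin r (- s)) as H4.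
    rewrite Rabs_Ropp in H4; fold (Rminus (r * B) s) in H4.
    pose proof (Rabs_pos (p * B + q)); pose proof (Rabs_pos (r * B - s)).
    pose proof (Rabs_pos (sin (a * B))); pose proof (Rabs_pos (cos (a * B))).
    nra. }
  rewrite Rabs_mult, (Rabs_pos_eq (exp _)) by lra.
  apply Rle_trans with
    ((Rabs p + Rabs q + Rabs r + Rabs s) * ((1 + B) * exp (- (m * B)))).
  - nra.
  - unfold Rdiv in *; rewrite Rmult_assoc; apply Rmult_le_compat_l; lra.
Qed.

Lemma sum_f_R0_bound_div (f : nat -> R -> R) (n : nat) :
  (forall k, exists c, forall B, 0 < B -> Rabs (f k B) <= c / B) ->
  exists c, forall B, 0 < B -> Rabs (sum_f_R0 (fun k => f k B) n) <= c / B.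
Proof.
  intros H; induction n as [|n [c IH]]; [apply H|].
  destruct (H (S n)) as [d Hd]; exists (c + d); intros B HB; simpl.
  eapply Rle_trans; [apply Rabs_triang|].
  unfold Rdiv; rewrite Rmult_plus_distr_r; apply Rplus_le_compat; auto.
Qed.

(** * The series of [1 / cosh^2] and the truncated integral *)

(** With [q = exp (-2x)] one has [1 / cosh^2 x = 4q / (1 + q)^2], and the right-hand side is the
    closed tail of an arithmetico-geometric series in [-q]. As an identity it also covers [x = 0],
    where the series diverges. *)
Lemma sech_sqr_partial_sum (x : R) (n : nat) :
  / cosh x ^ 2
  - sum_f_R0 (fun k => - 4 * (-1) ^ k * INR k * exp (- (2 * INR k * x))) n
  = 4 * (-1) ^ n * exp (- (2 * INR (S n) * x))
    * (INR (S n) + INR n * exp (- (2 * x))) / (1 + exp (- (2 * x))) ^ 2.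
Proof.
  pose proof (exp_pos (- x)) as Hp.
  assert (Hq : exp (- (2 * x)) = exp (- x) * exp (- x)).
  { rewrite <- exp_plus; f_equal; ring. }
  pose proof (exp_pos (- (2 * x))) as Hq0.
  induction n as [|n IH].
  - simpl sum_f_R0; simpl pow; simpl INR.
    replace (- (2 * 1 * x)) with (- (2 * x)) by ring.
    assert (He : exp x = / exp (- x)) by (rewrite exp_Ropp, Rinv_inv; trivial).
    unfold cosh; rewrite He, Hq; field; repeat split; nra.
  - rewrite tech5.
    set (S0 := sum_f_R0 _ n) in *.
    assert (HS : S0 = / cosh x ^ 2 - 4 * (-1) ^ n * exp (- (2 * INR (S n) * x))
    * (INR (S n) + INR n * exp (- (2 * x))) / (1 + exp (- (2 * x))) ^ 2) by lra.
    rewrite HS.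
    replace (exp (- (2 * INR (S (S n)) * x)))
      with (exp (- (2 * INR (S n) * x)) * exp (- (2 * x))).
    2:{ rewrite <- exp_plus; f_equal; rewrite (S_INR (S n)); ring. }
    assert (Hc : cosh x <> 0) by (unfold cosh; pose proof (exp_pos x); lra).
    set (e := exp (- (2 * INR (S n) * x))); set (q := exp (- (2 * x))) in *.
    rewrite !S_INR, <- !tech_pow_Rmult.
    field; split; nra.
Qed.

(** The numerator satisfies [n + 1 + n q <= (2n + 1) (1 + q) <= (2n + 1) (1 + q)^2]. The remainder
    is thus within twice the first omitted term, small enough for its integral against [x] to be
    [O(1/n)]. *)
Lemma sech_sqr_partial_sum_bound (x : R) (n : nat) :
  Rabs (/ cosh x ^ 2
  - sum_f_R0 (fun k => - 4 * (-1) ^ k * INR k * exp (- (2 * INR k * x))) n)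
  <= 4 * (2 * INR n + 1) * exp (- (2 * INR (S n) * x)).
Proof.
  rewrite sech_sqr_partial_sum.
  pose proof (exp_pos (- (2 * x))) as Hq; pose proof (exp_pos (- (2 * INR (S n) * x))) as He.
  pose proof (pos_INR n) as Hn.
  set (q := exp (- (2 * x))) in *; set (e := exp (- (2 * INR (S n) * x))) in *.
  unfold Rdiv; rewrite !Rabs_mult, pow_1_abs, (Rabs_pos_eq 4), (Rabs_pos_eq e) by lra.
  rewrite (Rabs_pos_eq (INR (S n) + INR n * q)) by (rewrite S_INR; nra).
  assert (Hd : 0 < (1 + q) ^ 2) by nra.
  rewrite (Rabs_pos_eq (/ _)) by (left; apply Rinv_0_lt_compat, Hd).
  apply Rmult_le_reg_r with ((1 + q) ^ 2); [trivial|].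
  rewrite S_INR.
  replace (4 * 1 * e * (INR n + 1 + INR n * q) * / (1 + q) ^ 2 * (1 + q) ^ 2)
    with (4 * e * (INR n + 1 + INR n * q)) by (field; lra).
  replace (4 * (2 * INR n + 1) * e * (1 + q) ^ 2)
    with (4 * e * ((2 * INR n + 1) * (1 + q) ^ 2)) by ring.
  apply Rmult_le_compat_l; [lra|].
  assert (1 + q <= (1 + q) ^ 2) by nra; nra.
Qed.

(* The last factor is the integral of [x sin (a x) exp (-2kx)] over the half-line. *)
Definition sech_sqr_series_term (a : R) (k : nat) : R :=
  - 4 * (-1) ^ k * INR k
  * (2 * a * (2 * INR k) / (a * a + (2 * INR k) * (2 * INR k)) ^ 2).

Lemma ex_RInt_integrand (a u v : R) :
  ex_RInt (fun x => x * sin (a * x) / cosh x ^ 2) u v.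
Proof.
  apply (ex_RInt_continuous (V := R_CompleteNormedModule)); intros x _.
  apply (ex_derive_continuous (V := R_NormedModule)).
  unfold cosh; auto_derive.
  pose proof (exp_pos x); pose proof (exp_pos (- x)); nra.
Qed.

(** The constant [c] may depend on [n] but not on [B], and the other error does not involve [B]. So
    [B] can be sent to infinity with [n] fixed, without exchanging limits. *)
Lemma truncated_integral_bound (a : R) (n : nat) : a <> 0 ->
  exists c, forall B, 0 < B ->
  Rabs (RInt (fun x => x * sin (a * x) / cosh x ^ 2) 0 B
        - sum_f_R0 (sech_sqr_series_term a) n) <= 2 * / INR (S n) + c / B.
Proof.
  intros Ha.
  set (w := fun k => - 4 * (-1) ^ k * INR k).
  destruct (sum_f_R0_bound_div
    (fun k B => w k * xsin_exp_primitive a (2 * INR k) B) n) as [c Hc].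
  { intros [|k].
    (* The term [k = 0] has no exponential decay, but its weight is zero. *)
    - exists 0; intros B HB; unfold w; simpl INR.
      rewrite Rmult_0_r, Rmult_0_l, Rabs_R0; unfold Rdiv; lra.
    - destruct (xsin_exp_primitive_bound a (2 * INR (S k))) as [c Hc].
      { rewrite S_INR; pose proof (pos_INR k); lra. }
      exists (Rabs (w (S k)) * c); intros B HB; rewrite Rabs_mult.
      unfold Rdiv; rewrite Rmult_assoc; apply Rmult_le_compat_l;
        [apply Rabs_pos | apply (Hc B HB)]. }
  exists c; intros B HB; specialize (Hc B HB).
  pose proof (RInt_correct _ _ _ (ex_RInt_integrand a 0 B)) as HI.
  set (I := RInt _ 0 B) in *.
  (* The lower endpoint of each primitive yields the series term, the upper one an error of order
     [1 / B]. *)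
  assert (HP : is_RInt (fun x => sum_f_R0 (fun k =>
      w k * (x * sin (a * x) * exp (- (2 * INR k * x)))) n) 0 B
      (sum_f_R0 (sech_sqr_series_term a) n +
       sum_f_R0 (fun k => w k * xsin_exp_primitive a (2 * INR k) B) n)).
  { rewrite <- sum_plus; apply is_RInt_sum_f_R0; intros k.
    replace (_ + _) with (scal (w k) (xsin_exp_primitive a (2 * INR k) B
      - xsin_exp_primitive a (2 * INR k) 0)).
    2:{ rewrite xsin_exp_primitive_0; unfold sech_sqr_series_term, w, scal; simpl;
        unfold mult; simpl; ring. }
    apply (is_RInt_scal (V := R_NormedModule)).
    apply is_RInt_xsin_exp, Ha. }
  pose proof (is_RInt_minus (V := R_NormedModule) _ _ _ _ _ _ HI HP) as HD.
  assert (HN : 0 < 2 * INR (S n)) by (rewrite S_INR; pose proof (pos_INR n); lra).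
  pose proof (is_RInt_scal (V := R_NormedModule) _ _ _ (4 * (2 * INR n + 1)) _
    (is_RInt_x_exp (2 * INR (S n)) B HN)) as HE.
  set (P := sum_f_R0 (sech_sqr_series_term a) n) in *.
  set (E := sum_f_R0 (fun k => w k * _) n) in *.
  set (T := scal _ _) in HE.
  assert (Hle : Rabs (I - (P + E)) <= T).
  { refine (norm_RInt_le (V := R_NormedModule) _ _ 0 B _ _ (Rlt_le _ _ HB) _ HD HE).
    intros x [Hx0 HxB].
    change (Rabs (x * sin (a * x) / cosh x ^ 2 - sum_f_R0 (fun k =>
      w k * (x * sin (a * x) * exp (- (2 * INR k * x)))) n)
      <= 4 * (2 * INR n + 1) * (x * exp (- (2 * INR (S n) * x)))).
    pose proof (sech_sqr_partial_sum_bound x n) as Hb.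
    replace (sum_f_R0 _ n) with (x * sin (a * x) * sum_f_R0 (fun k =>
      - 4 * (-1) ^ k * INR k * exp (- (2 * INR k * x))) n).
    2:{ rewrite scal_sum; apply sum_eq; intros; unfold w; ring. }
    unfold Rdiv; rewrite <- Rmult_minus_distr_l, !Rabs_mult, (Rabs_pos_eq x) by trivial.
    assert (Hs : Rabs (sin (a * x)) <= 1) by (apply Rabs_le; apply SIN_bound).
    set (d := Rabs (_ - _)) in *.
    pose proof (Rabs_pos (sin (a * x))).
    assert (0 <= d) by apply Rabs_pos.
    apply Rle_trans with (x * d).
    - apply Rmult_le_compat_r; trivial; nra.
    - nra. }
  (* Dropping the negative endpoint term leaves [4 (2n + 1) / (2 (n + 1))^2 = (2n + 1) / (n +
     1)^2]. *)
  assert (HT : T <= 2 * / INR (S n)).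
  { unfold T, scal; simpl; unfold mult; simpl.
    change (match n with O => 1 | S _ => INR n + 1 end) with (INR (S n)).
    pose proof (exp_pos (- (2 * INR (S n) * B))) as He.
    set (e := exp _) in *; rewrite S_INR in *.
    pose proof (pos_INR n); set (p := INR n) in *.
    apply Rle_trans with (4 * (2 * p + 1) * (1 / (2 * (p + 1)) ^ 2)).
    - apply Rmult_le_compat_l; [lra|].
      assert (0 <= (B / (2 * (p + 1)) + 1 / (2 * (p + 1)) ^ 2) * e).
      { apply Rmult_le_pos; [|lra]; apply Rplus_le_le_0_compat.
        - apply Rlt_le, Rdiv_lt_0_compat; lra.
        - apply Rlt_le, Rdiv_lt_0_compat; nra. }
      simpl pow in *; lra.
    - apply Rmult_le_reg_r with ((p + 1) ^ 2); [nra|].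
      replace (4 * (2 * p + 1) * (1 / (2 * (p + 1)) ^ 2) * (p + 1) ^ 2)
        with (2 * p + 1) by (field; lra).
      replace (2 * / (p + 1) * (p + 1) ^ 2) with (2 * (p + 1)) by (field; lra).
      lra. }
  change (Rabs E <= c / B) in Hc.
  replace (I - P) with ((I - (P + E)) + E) by ring.
  eapply Rle_trans; [apply Rabs_triang|]; lra.
Qed.

(** * Dirichlet and Fejer kernels *)

(** The usual kernel [1 + 2 sum_(k=1)^n cos (k u)] at [u = 2t]; the summand [k = 0] contributes 2,
    hence the [- 1]. *)
Definition dirichlet_kernel (n : nat) (t : R) : R :=
  sum_f_R0 (fun k => 2 * cos (2 * INR k * t)) n - 1.

(** Telescoping of [2 sin t cos (2kt) = sin ((2k+1)t) - sin ((2k-1)t)]. The product form avoids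
    dividing at the zeros of [sin]. *)
Lemma sin_mul_dirichlet_kernel (n : nat) (t : R) :
  sin t * dirichlet_kernel n t = sin ((2 * INR n + 1) * t).
Proof.
  unfold dirichlet_kernel; induction n as [|n IH].
  - simpl; rewrite Rmult_0_r, Rmult_0_l, cos_0, Rplus_0_l, Rmult_1_l; ring.
  - rewrite tech5.
    replace ((2 * INR (S n) + 1) * t) with (2 * INR (S n) * t + t) by ring.
    replace ((2 * INR n + 1) * t) with (2 * INR (S n) * t - t) in IH
      by (rewrite S_INR; ring).
    rewrite sin_plus; rewrite sin_minus in IH; lra.
Qed.

(** Telescoping of [sin t sin ((2n+1)t) = sin^2 ((n+1)t) - sin^2 (nt)]. It shows that the Fejer sum
    times [sin^2 t] lies in [[0, 1]] for every [N]. *)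
Lemma sin_sqr_mul_fejer_sum (N : nat) (t : R) :
  sin t ^ 2 * sum_f_R0 (fun n => dirichlet_kernel n t) N = sin (INR (S N) * t) ^ 2.
Proof.
  induction N as [|N IH].
  - unfold dirichlet_kernel; simpl.
    rewrite Rmult_0_r, Rmult_0_l, cos_0, !Rmult_1_l; ring.
  - rewrite tech5, Rmult_plus_distr_l, IH.
    replace (sin t ^ 2 * dirichlet_kernel (S N) t)
      with (sin t * (sin t * dirichlet_kernel (S N) t)) by ring.
    rewrite sin_mul_dirichlet_kernel.
    replace ((2 * INR (S N) + 1) * t) with (2 * (INR (S N) * t) + t) by ring.
    replace (INR (S (S N)) * t) with (INR (S N) * t + t)
      by (rewrite (S_INR (S N)); ring).
    set (v := INR (S N) * t).
    rewrite !sin_plus, sin_2a, cos_2a.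
    pose proof (sin2_cos2 v) as Hv; pose proof (sin2_cos2 t) as Ht; unfold Rsqr in *.
    replace (cos v * cos v) with (1 - sin v * sin v) by lra.
    replace ((sin v * cos t + cos v * sin t) ^ 2) with
      (sin v * sin v * (cos t * cos t) + 2 * sin v * cos v * sin t * cos t
       + cos v * cos v * (sin t * sin t)) by ring.
    replace (cos v * cos v) with (1 - sin v * sin v) by lra.
    replace (cos t * cos t) with (1 - sin t * sin t) by lra.
    ring.
Qed.

Lemma is_RInt_mul_dirichlet_kernel (h : R -> R) (e : nat -> R) (u v : R) (n : nat) :
  (forall k, is_RInt (fun t => h t * cos (2 * INR k * t)) u v (e k)) ->
  is_RInt (fun t => h t * dirichlet_kernel n t) u v
    (sum_f_R0 (fun k => 2 * e k) n - e 0%nat).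
Proof.
  intros H.
  (* The [- 1] of the kernel is read as minus the cosine of frequency 0, which produces [- e 0]. *)
  apply is_RInt_ext with (fun t =>
    sum_f_R0 (fun k => 2 * (h t * cos (2 * INR k * t))) n
    - h t * cos (2 * INR 0 * t)).
  { intros t _; unfold dirichlet_kernel; simpl INR.
    rewrite Rmult_0_r, Rmult_0_l, cos_0, Rmult_minus_distr_l.
    f_equal; rewrite scal_sum; apply sum_eq; intros; ring. }
  apply (is_RInt_minus (V := R_NormedModule)); [|apply H].
  apply is_RInt_sum_f_R0; intros k.
  apply (is_RInt_scal (V := R_NormedModule)), H.
Qed.

Lemma cos_INR_PI (k : nat) : cos (INR k * PI) = (-1) ^ k.
Proof.
  induction k as [|k IH]; [simpl; rewrite Rmult_0_l; apply cos_0|].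
  rewrite S_INR, Rmult_plus_distr_r, Rmult_1_l, neg_cos, IH; simpl; ring.
Qed.

Lemma sin_INR_PI (k : nat) : sin (INR k * PI) = 0.
Proof.
  induction k as [|k IH]; [simpl; rewrite Rmult_0_l; apply sin_0|].
  rewrite S_INR, Rmult_plus_distr_r, Rmult_1_l, neg_sin, IH; ring.
Qed.

(** For [k >= 1] the cosines integrate to [sin (k PI) / (2k) = 0]; frequency 0 leaves
    [2 (PI/2) - PI/2]. *)
Lemma is_RInt_dirichlet_kernel (n : nat) :
  is_RInt (dirichlet_kernel n) 0 (PI / 2) (PI / 2).
Proof.
  pose (e := fun k : nat => match k with O => PI / 2 | S _ => 0 end).
  apply is_RInt_ext with (fun t => 1 * dirichlet_kernel n t).
  { intros; apply Rmult_1_l. }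
  replace (PI / 2) with (sum_f_R0 (fun k => 2 * e k) n - e 0%nat) at 2.
  2:{ assert (sum_f_R0 (fun k => 2 * e k) n = PI).
      { induction n as [|n IH]; [simpl; field|]; simpl; rewrite IH; ring. }
      simpl; lra. }
  apply is_RInt_mul_dirichlet_kernel; intros [|k].
  - apply is_RInt_ext with (fun _ => 1).
    { intros t _; simpl; rewrite Rmult_0_r, Rmult_0_l, cos_0; ring. }
    replace (e 0%nat) with (scal (PI / 2 - 0) 1).
    2:{ unfold scal; simpl; unfold mult; simpl; field. }
    apply (is_RInt_const (V := R_NormedModule)).
  - assert (Hk : 2 * INR (S k) <> 0) by (pose proof (pos_INR k); rewrite S_INR; lra).
    assert (Hm : 2 * INR (S k) * (PI / 2) = INR (S k) * PI) by field.
    set (m := 2 * INR (S k)) in *; clearbody m.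
    pose (F := fun t => sin (m * t) / m).
    replace (e (S k)) with (F (PI / 2) - F 0).
    2:{ unfold F; rewrite Hm.
        rewrite sin_INR_PI, Rmult_0_r, sin_0; simpl; unfold Rdiv; ring. }
    apply is_RInt_antiderivative.
    + intros t; unfold F; auto_derive; [trivial|]; field; trivial.
    + intros t; auto_derive; trivial.
Qed.

(** * Cosine coefficients of the weight *)

(** At [PI / 2] the sine of the primitive vanishes and its cosine is [(-1)^k]: this reproduces the
    alternating signs of the series. *)
Lemma is_RInt_cosh_cos (a : R) (k : nat) : a <> 0 ->
  is_RInt (fun t => cosh (a * t) * cos (2 * INR k * t)) 0 (PI / 2)
    (a * (-1) ^ k * sinh (a * PI / 2) / (a * a + (2 * INR k) * (2 * INR k))).
Proof.
  intros Ha; set (m := 2 * INR k).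
  pose proof (sum_sqr_neq_0 a m Ha) as HD.
  pose (F := fun t => (a * sinh (a * t) * cos (m * t) + m * cosh (a * t) * sin (m * t))
    / (a * a + m * m)).
  replace (a * (-1) ^ k * _ / _) with (F (PI / 2) - F 0).
  2:{ unfold F; replace (m * (PI / 2)) with (INR k * PI) by (unfold m; field).
      rewrite cos_INR_PI, sin_INR_PI, !Rmult_0_r, sin_0, sinh_0.
      replace (a * (PI / 2)) with (a * PI / 2) by field.
      field; trivial. }
  apply is_RInt_antiderivative.
  - intros t; unfold F, sinh, cosh; auto_derive; [trivial|]; field; trivial.
  - intros t; unfold cosh; auto_derive; trivial.
Qed.

(** Both the value and the primitive [F] are the derivatives in [a] of those in
    [is_RInt_cosh_cos]. *)
Lemma is_RInt_tsinh_cos (a : R) (k : nat) : a <> 0 ->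
  is_RInt (fun t => t * sinh (a * t) * cos (2 * INR k * t)) 0 (PI / 2)
    ((-1) ^ k * ((sinh (a * PI / 2) + a * (PI / 2) * cosh (a * PI / 2))
                   / (a * a + (2 * INR k) * (2 * INR k))
      - 2 * a * a * sinh (a * PI / 2) / (a * a + (2 * INR k) * (2 * INR k)) ^ 2)).
Proof.
  intros Ha; set (m := 2 * INR k).
  pose proof (sum_sqr_neq_0 a m Ha) as HD.
  pose (F := fun t =>
    (sinh (a * t) * cos (m * t)
     + t * (a * cosh (a * t) * cos (m * t) + m * sinh (a * t) * sin (m * t)))
      / (a * a + m * m)
    - 2 * a * (a * sinh (a * t) * cos (m * t) + m * cosh (a * t) * sin (m * t))
      / (a * a + m * m) ^ 2).
  replace ((-1) ^ k * _) with (F (PI / 2) - F 0).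
  2:{ unfold F; replace (m * (PI / 2)) with (INR k * PI) by (unfold m; field).
      rewrite cos_INR_PI, sin_INR_PI, !Rmult_0_r, sin_0, sinh_0.
      replace (a * (PI / 2)) with (a * PI / 2) by field.
      field; trivial. }
  apply is_RInt_antiderivative.
  - intros t; unfold F, sinh, cosh; auto_derive; [trivial|]; field; trivial.
  - intros t; unfold sinh; auto_derive; trivial.
Qed.

(* The derivative of [a * cosh (a t) / sinh (a PI / 2)] with respect to [a]. *)
Definition fejer_weight (a t : R) : R :=
  (sinh (a * PI / 2) - a * (PI / 2) * cosh (a * PI / 2)) / sinh (a * PI / 2) ^ 2
    * cosh (a * t)
  + a / sinh (a * PI / 2) * (t * sinh (a * t)).

(** With [m = 2k], dividing by [sinh (a PI / 2)] makes the coefficient of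
    [a cosh (a t) / sinh (a PI / 2)] equal to [(-1)^k a^2 / (a^2 + m^2)]. Its derivative in [a] is
    [(-1)^k 2 a m^2 / (a^2 + m^2)^2]. *)
Lemma is_RInt_fejer_weight_cos (a : R) (k : nat) : a <> 0 ->
  is_RInt (fun t => fejer_weight a t * cos (2 * INR k * t)) 0 (PI / 2)
    (- sech_sqr_series_term a k / 2).
Proof.
  intros Ha.
  assert (Hs : sinh (a * PI / 2) <> 0).
  { apply sinh_neq_0; pose proof PI_RGT_0 as HPI.
    intros H; apply Ha; nra. }
  pose proof (sum_sqr_neq_0 a (2 * INR k) Ha) as HD.
  set (al := (sinh (a * PI / 2) - a * (PI / 2) * cosh (a * PI / 2))
    / sinh (a * PI / 2) ^ 2).
  pose proof (is_RInt_plus (V := R_NormedModule) _ _ _ _ _ _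
    (is_RInt_scal (V := R_NormedModule) _ _ _ al _ (is_RInt_cosh_cos a k Ha))
    (is_RInt_scal (V := R_NormedModule) _ _ _ (a / sinh (a * PI / 2)) _
      (is_RInt_tsinh_cos a k Ha))) as H.
  match type of H with is_RInt _ _ _ ?l =>
    replace (- sech_sqr_series_term a k / 2) with l end.
  - revert H; apply is_RInt_ext; intros t _.
    unfold fejer_weight; fold al; unfold plus, scal; simpl; unfold mult; simpl; ring.
  - unfold al, plus, scal; simpl; unfold mult; simpl.
    unfold sech_sqr_series_term; field; auto.
Qed.

Lemma is_RInt_fejer_weight_dirichlet_kernel (a : R) (n : nat) : a <> 0 ->
  is_RInt (fun t => fejer_weight a t * dirichlet_kernel n t) 0 (PI / 2)
    (- sum_f_R0 (sech_sqr_series_term a) n).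
Proof.
  intros Ha.
  pose proof (is_RInt_mul_dirichlet_kernel _ _ _ _ n
    (fun k => is_RInt_fejer_weight_cos a k Ha)) as H.
  replace (- sum_f_R0 _ n) with
    (sum_f_R0 (fun k => 2 * (- sech_sqr_series_term a k / 2)) n
     - - sech_sqr_series_term a 0 / 2); [trivial|].
  (* The weight has zero mean on [[0, PI / 2]], so the correction for frequency 0 disappears. *)
  assert (H0 : sech_sqr_series_term a 0 = 0).
  { unfold sech_sqr_series_term; simpl; unfold Rdiv; ring. }
  rewrite H0.
  replace (- sum_f_R0 (sech_sqr_series_term a) n)
    with (-1 * sum_f_R0 (sech_sqr_series_term a) n) by ring.
  rewrite scal_sum.
  replace (sum_f_R0 (fun k => 2 * (- sech_sqr_series_term a k / 2)) n)
    with (sum_f_R0 (fun i => sech_sqr_series_term a i * -1) n); [field|].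
  apply sum_eq; intros; field.
Qed.

(** * Quadratic flatness of the weight at 0 *)

(** Mean value theorem from 0, with [cosh <= exp M] on [[-M, M]]. *)
Lemma Rabs_sinh_le (u M : R) : Rabs u <= M -> Rabs (sinh u) <= exp M * Rabs u.
Proof.
  intros Hu.
  destruct (MVT_gen sinh 0 u cosh) as [c [Hc Heq]].
  - intros x _; apply is_derive_Reals, derivable_pt_lim_sinh.
  - intros x _; apply derivable_continuous_pt, derivable_pt_sinh.
  - rewrite sinh_0, !Rminus_0_r in Heq; rewrite Heq, Rabs_mult.
    apply Rmult_le_compat_r; [apply Rabs_pos|].
    assert (Hcu : - M <= c <= M).
    { revert Hc Hu; unfold Rmin, Rmax, Rabs.
      destruct (Rle_dec 0 u), (Rcase_abs u); lra. }
    unfold cosh; pose proof (exp_pos c); pose proof (exp_pos (- c)).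
    rewrite Rabs_pos_eq by lra.
    assert (exp c <= exp M).
    { destruct (Rle_lt_or_eq_dec c M (proj2 Hcu)) as [H1|<-];
        [left; apply exp_increasing; lra|lra]. }
    assert (exp (- c) <= exp M).
    { destruct (Req_dec (- c) M) as [->|Hne]; [lra|].
      left; apply exp_increasing; lra. }
    lra.
Qed.

(** From [PI <= 4] comes [t <= 2], so [sin t >= t - t^3 / 6 >= t (1 - 4/6)]. *)
Lemma le_3_sin (t : R) : 0 <= t <= PI / 2 -> t <= 3 * sin t.
Proof.
  intros [H0 H1]; pose proof PI_4 as H4.
  destruct (sin_bound t 0) as [Hs _]; [lra|lra|].
  unfold sin_approx, sin_term in Hs; simpl in Hs.
  nra.
Qed.

(** Both [cosh (a t) - 1 = 2 sinh^2 (a t / 2)] and [t sinh (a t)] are [O(t^2)], and [le_3_sin] turns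
    [t^2] into [sin^2 t], the factor that tames the Fejer sum. *)
Lemma fejer_weight_sub_bound (a : R) :
  exists C, 0 <= C /\ forall t, 0 <= t <= PI / 2 ->
  Rabs (fejer_weight a t - fejer_weight a 0) <= C * sin t ^ 2.
Proof.
  unfold fejer_weight; set (al := _ / sinh _ ^ 2); set (be := a / _).
  (* As [t <= PI / 2 <= 2], the arguments [a t] and [a t / 2] are at most [Rabs a * 2] in absolute
     value. *)
  set (E := exp (Rabs a * 2)).
  assert (HE : 0 < E) by apply exp_pos.
  pose proof (Rabs_pos al) as Hal; pose proof (Rabs_pos be) as Hbe.
  pose proof (Rabs_pos a) as Haa.
  set (K := Rabs al * (2 * (E * Rabs a) ^ 2) + Rabs be * (E * Rabs a)).
  assert (HEa : 0 <= E * Rabs a) by nra.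
  assert (HK : 0 <= K) by (unfold K; pose proof (pow2_ge_0 (E * Rabs a));
    apply Rplus_le_le_0_compat; apply Rmult_le_pos; lra).
  (* [K] is the constant against [t^2], and 9 is the square of the 3 in [le_3_sin]. *)
  exists (9 * K); split; [lra|]; intros t Ht.
  pose proof (le_3_sin t Ht) as Hs; pose proof PI_4 as HPI.
  assert (Hat : Rabs (a * t) <= Rabs a * 2).
  { rewrite Rabs_mult, (Rabs_pos_eq t) by lra; apply Rmult_le_compat_l; lra. }
  pose proof (Rabs_sinh_le _ _ Hat) as H1; fold E in H1.
  assert (Hat2 : Rabs (a * t / 2) <= Rabs a * 2).
  { unfold Rdiv; rewrite Rabs_mult, (Rabs_pos_eq (/ 2)) by lra.
    pose proof (Rabs_pos (a * t)); lra. }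
  pose proof (Rabs_sinh_le _ _ Hat2) as H2; fold E in H2.
  assert (Hc : cosh (a * t) - 1 = 2 * sinh (a * t / 2) ^ 2).
  { unfold cosh, sinh.
    assert (He : exp (a * t / 2) * exp (- (a * t / 2)) = 1).
    { rewrite <- exp_plus, <- exp_0; f_equal; lra. }
    replace (exp (a * t)) with (exp (a * t / 2) * exp (a * t / 2))
      by (rewrite <- exp_plus; f_equal; lra).
    replace (exp (- (a * t))) with (exp (- (a * t / 2)) * exp (- (a * t / 2)))
      by (rewrite <- exp_plus; f_equal; lra).
    nra. }
  rewrite !Rmult_0_r, cosh_0, Rmult_0_l, Rmult_0_r, Rplus_0_r, Rmult_1_r.
  replace (al * cosh (a * t) + be * (t * sinh (a * t)) - al)
    with (al * (cosh (a * t) - 1) + be * (t * sinh (a * t))) by ring.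
  rewrite Hc.
  eapply Rle_trans; [apply Rabs_triang|].
  rewrite !Rabs_mult, <- RPow_abs, (Rabs_pos_eq 2), (Rabs_pos_eq t) by lra.
  replace (Rabs (a * t)) with (Rabs a * t) in H1
    by (rewrite Rabs_mult, (Rabs_pos_eq t); lra).
  replace (Rabs (a * t / 2)) with (Rabs a * t / 2) in H2
    by (unfold Rdiv; rewrite !Rabs_mult, (Rabs_pos_eq t), (Rabs_pos_eq (/ 2)); lra).
  pose proof (Rabs_pos (sinh (a * t))); pose proof (Rabs_pos (sinh (a * t / 2))).
  set (s1 := Rabs (sinh (a * t))) in *; set (s2 := Rabs (sinh (a * t / 2))) in *.
  apply Rle_trans with (K * t ^ 2).
  - unfold K; rewrite Rmult_plus_distr_r; apply Rplus_le_compat.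
    + rewrite Rmult_assoc; apply Rmult_le_compat_l; [trivial|].
      assert (s2 <= (E * Rabs a) * t) by nra.
      assert (s2 ^ 2 <= ((E * Rabs a) * t) ^ 2) by (apply pow_incr; lra).
      nra.
    + rewrite Rmult_assoc; apply Rmult_le_compat_l; [trivial|].
      assert (s1 <= (E * Rabs a) * t) by lra; nra.
  - assert (t ^ 2 <= (3 * sin t) ^ 2) by (apply pow_incr; lra).
    nra.
Qed.

(** * Cesaro means and the limit of the integral *)

(** Subtracting [fejer_weight a 0] from the weight leaves an integrand bounded by
    [C sin^2 ((N+1)t) <= C]. The error is therefore bounded before division by [N + 1]. *)
Lemma fejer_mean_bound (a : R) : a <> 0 ->
  exists C, forall N,
  Rabs (sum_f_R0 (sum_f_R0 (sech_sqr_series_term a)) N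
        + INR (S N) * (fejer_weight a 0 * (PI / 2))) <= C.
Proof.
  intros Ha; destruct (fejer_weight_sub_bound a) as [C [HC0 HC]].
  exists (PI / 2 * C); intros N.
  pose proof PI_RGT_0 as HPI.
  set (K := fun t => sum_f_R0 (fun n => dirichlet_kernel n t) N).
  set (al := fejer_weight a 0) in *.
  assert (H1 : is_RInt (fun t => fejer_weight a t * K t) 0 (PI / 2)
    (sum_f_R0 (fun n => - sum_f_R0 (sech_sqr_series_term a) n) N)).
  { apply is_RInt_ext with (fun t =>
      sum_f_R0 (fun n => fejer_weight a t * dirichlet_kernel n t) N).
    { intros t _; unfold K; rewrite scal_sum; apply sum_eq; intros; ring. }
    apply is_RInt_sum_f_R0; intros n.
    apply is_RInt_fejer_weight_dirichlet_kernel, Ha. }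
  assert (H2 : is_RInt (fun t => al * K t) 0 (PI / 2)
    (al * sum_f_R0 (fun _ => PI / 2) N)).
  { apply (is_RInt_scal (V := R_NormedModule)).
    apply is_RInt_sum_f_R0, is_RInt_dirichlet_kernel. }
  pose proof (is_RInt_minus (V := R_NormedModule) _ _ _ _ _ _ H1 H2) as H3.
  pose proof (is_RInt_const (V := R_NormedModule) 0 (PI / 2) C) as H4.
  assert (H5 : Rabs (sum_f_R0 (fun n => - sum_f_R0 (sech_sqr_series_term a) n) N
    - al * sum_f_R0 (fun _ => PI / 2) N) <= (PI / 2 - 0) * C).
  { refine (norm_RInt_le (V := R_NormedModule) _ _ _ _ _ _ _ _ H3 H4); [lra|].
    intros t Ht.
    change (Rabs (fejer_weight a t * K t - al * K t) <= C).
    rewrite <- Rmult_minus_distr_r, Rabs_mult.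
    apply Rle_trans with (C * sin t ^ 2 * Rabs (K t)).
    - apply Rmult_le_compat_r; [apply Rabs_pos | apply HC, Ht].
    - rewrite <- (Rabs_pos_eq (sin t ^ 2)) by apply pow2_ge_0.
      rewrite Rmult_assoc, <- Rabs_mult; unfold K; rewrite sin_sqr_mul_fejer_sum.
      pose proof (SIN_bound (INR (S N) * t)).
      rewrite Rabs_pos_eq by apply pow2_ge_0.
      assert (sin (INR (S N) * t) ^ 2 <= 1) by nra; nra. }
  rewrite sum_cte in H5.
  replace (sum_f_R0 (fun n => - sum_f_R0 (sech_sqr_series_term a) n) N)
    with (- sum_f_R0 (sum_f_R0 (sech_sqr_series_term a)) N) in H5.
  2:{ clear; induction N as [|N IH]; simpl; [trivial|]; rewrite <- IH; simpl; ring. }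
  rewrite <- Rabs_Ropp, Rminus_0_r in H5.
  match goal with |- Rabs ?x <= _ => match type of H5 with Rabs ?y <= _ =>
    replace x with y by ring end end.
  exact H5.
Qed.

(** Adds the truncation bounds for [n = 0, ..., N]. The harmonic-type sum is left unevaluated, since
    its Cesaro mean tends to 0 along with its terms. *)
Lemma sum_truncated_integral_bound (a : R) (N : nat) : a <> 0 ->
  exists c, forall B, 0 < B ->
  Rabs (INR (S N) * RInt (fun x => x * sin (a * x) / cosh x ^ 2) 0 B
        - sum_f_R0 (sum_f_R0 (sech_sqr_series_term a)) N)
  <= sum_f_R0 (fun n => 2 * / INR (S n)) N + c / B.
Proof.
  intros Ha; induction N as [|N [c IH]].
  - destruct (truncated_integral_bound a 0 Ha) as [c Hc]; exists c; intros B HB.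
    change (INR 1) with 1; rewrite Rmult_1_l; apply (Hc B HB).
  - destruct (truncated_integral_bound a (S N) Ha) as [d Hd].
    exists (c + d); intros B HB; specialize (IH B HB); specialize (Hd B HB).
    set (I := RInt _ 0 B) in *.
    rewrite (tech5 (sum_f_R0 _) N), (tech5 (fun n => 2 * / INR (S n)) N).
    rewrite (S_INR (S N)) at 1.
    replace ((c + d) / B) with (c / B + d / B) by (field; lra).
    match goal with |- Rabs ?x <= _ => replace x with
      ((INR (S N) * I - sum_f_R0 (sum_f_R0 (sech_sqr_series_term a)) N)
       + (I - sum_f_R0 (sech_sqr_series_term a) (S N))) by ring end.
    eapply Rle_trans; [apply Rabs_triang|]; lra.
Qed.

(** After multiplication by [N + 1] there are three errors, each made smaller than
    [(N + 1) eps / 3]: the truncation sum and the Fejer error by the choice of [N], then [c / B] by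
    that of [B], as [c] depends on [N]. *)
Lemma RInt_integrand_cvg (a : R) : a <> 0 -> forall eps : posreal,
  exists M, forall B, M < B ->
  Rabs (RInt (fun x => x * sin (a * x) / cosh x ^ 2) 0 B
        - - (fejer_weight a 0 * (PI / 2))) < eps.
Proof.
  intros Ha eps.
  destruct (fejer_mean_bound a Ha) as [C HC].
  pose proof (cond_pos eps) as He.
  assert (Hcv : Un_cv (fun n => 2 * / INR (S n)) 0).
  { intros e Hpos.
    destruct (archimed_cor1 (e / 2)) as [n [Hn Hn0]]; [lra|].
    exists n; intros k Hk; unfold R_dist; rewrite Rminus_0_r.
    assert (H0 : 0 < INR n) by (apply lt_0_INR; lia).
    assert (H1 : INR n < INR (S k)) by (apply lt_INR; lia).
    assert (0 < / INR (S k)) by (apply Rinv_0_lt_compat; lra).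
    assert (/ INR (S k) < / INR n) by (apply Rinv_lt_contravar; nra).
    rewrite Rabs_pos_eq by lra; lra. }
  destruct (Cesaro_1 _ _ Hcv (eps / 3)) as [N1 HN1]; [lra|].
  destruct (archimed_cor1 (eps / (3 * (Rabs C + 1)))) as [N2 [HN2 HN20]].
  { pose proof (Rabs_pos C); apply Rdiv_lt_0_compat; lra. }
  set (N := (N1 + N2)%nat).
  specialize (HN1 (S N)); simpl pred in HN1; specialize (HC N).
  destruct (sum_truncated_integral_bound a N Ha) as [c Hc].
  exists (3 * (Rabs c + 1) / eps); intros B HB.
  pose proof (Rabs_pos c) as Hc0; pose proof (Rabs_pos C) as HC0.
  assert (HB0 : 0 < B).
  { eapply Rlt_trans; [|exact HB]; apply Rdiv_lt_0_compat; lra. }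
  specialize (Hc B HB0); set (I := RInt _ 0 B) in *.
  set (L := fejer_weight a 0 * (PI / 2)) in *.
  set (s := sum_f_R0 (sum_f_R0 _) N) in *.
  set (r := sum_f_R0 (fun n => 2 * / INR (S n)) N) in *.
  assert (HN2' : INR N2 <= INR (S N)) by (apply le_INR; unfold N; lia).
  assert (HN2'' : 0 < INR N2) by (apply lt_0_INR; lia).
  assert (H1N : 1 <= INR (S N)) by (rewrite S_INR; pose proof (pos_INR N); lra).
  assert (H1 : r < INR (S N) * (eps / 3)).
  { assert (Hr : R_dist (r / INR (S N)) 0 < eps / 3) by (apply HN1; unfold N; lia).
    unfold R_dist in Hr; rewrite Rminus_0_r in Hr.
    pose proof (Rle_abs (r / INR (S N))).
    replace r with (INR (S N) * (r / INR (S N))) by (field; lra).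
    apply Rmult_lt_compat_l; lra. }
  assert (H2 : C < INR (S N) * (eps / 3)).
  { apply Rlt_le_trans with (INR N2 * (eps / 3)).
    - pose proof (Rle_abs C).
      apply Rmult_lt_compat_l with (r := INR N2 * (Rabs C + 1)) in HN2; [|nra].
      replace (INR N2 * (Rabs C + 1) * / INR N2) with (Rabs C + 1) in HN2
        by (field; lra).
      replace (INR N2 * (Rabs C + 1) * (eps / (3 * (Rabs C + 1))))
        with (INR N2 * (eps / 3)) in HN2 by (field; lra).
      lra.
    - apply Rmult_le_compat_r; lra. }
  assert (H3 : c / B < INR (S N) * (eps / 3)).
  { apply Rlt_le_trans with (eps / 3); [|nra].
    apply Rmult_lt_reg_r with B; [trivial|].
    replace (c / B * B) with c by (field; lra).
    apply Rmult_lt_compat_r with (r := eps / 3) in HB; [|lra].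
    replace (3 * (Rabs c + 1) / eps * (eps / 3)) with (Rabs c + 1) in HB
      by (field; lra).
    pose proof (Rle_abs c); lra. }
  apply Rmult_lt_reg_l with (INR (S N)); [lra|].
  rewrite <- (Rabs_pos_eq (INR (S N))) at 1 by lra.
  rewrite <- Rabs_mult.
  replace (INR (S N) * (I - - L)) with ((INR (S N) * I - s) + (s + INR (S N) * L))
    by ring.
  eapply Rle_lt_trans; [apply Rabs_triang|]; lra.
Qed.

Theorem mainTheorem3 (a : R) (ha : a <> 0) :
  ex_RInt_gen (fun x : R => x * sin (a * x) / (cosh x) ^ 2)
    (at_point 0) (Rbar_locally p_infty) /\
  RInt_gen (fun x : R => x * sin (a * x) / (cosh x) ^ 2)
    (at_point 0) (Rbar_locally p_infty)
  = PI / 4 * (- 2 + a * PI * coth (PI * a / 2)) * csch (a * PI / 2) /\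
  ex_derive (fun b : R => PI * b / (2 * sinh (PI * b / 2))) a /\
  PI / 4 * (- 2 + a * PI * coth (PI * a / 2)) * csch (a * PI / 2)
  = - Derive (fun b : R => PI * b / (2 * sinh (PI * b / 2))) a.
Proof.
  assert (Hs : sinh (a * PI / 2) <> 0).
  { apply sinh_neq_0; pose proof PI_RGT_0 as HPI; intros H; apply ha; nra. }
  assert (HI : is_RInt_gen (fun x : R => x * sin (a * x) / (cosh x) ^ 2)
    (at_point 0) (Rbar_locally p_infty)
    (PI / 4 * (- 2 + a * PI * coth (PI * a / 2)) * csch (a * PI / 2))).
  { replace (PI / 4 * _ * _) with (- (fejer_weight a 0 * (PI / 2))).
    2:{ unfold fejer_weight, coth, csch; rewrite Rmult_0_r, cosh_0, Rmult_0_l.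
        rewrite (Rmult_comm PI a); field; trivial. }
    intros P [eps HP].
    destruct (RInt_integrand_cvg a ha eps) as [M HM].
    exists (fun x => x = 0) (fun y => M < y).
    - reflexivity.
    - exists M; trivial.
    - intros x y -> Hy; exists (RInt (fun x => x * sin (a * x) / cosh x ^ 2) 0 y).
      split; [apply (RInt_correct (V := R_CompleteNormedModule)), ex_RInt_integrand
        | apply HP, HM, Hy]. }
  assert (HD : is_derive (fun b : R => PI * b / (2 * sinh (PI * b / 2))) a
    (- (PI / 4 * (- 2 + a * PI * coth (PI * a / 2)) * csch (a * PI / 2)))).
  { unfold coth, csch; rewrite !(Rmult_comm a PI) in *; unfold sinh, cosh in *.
    auto_derive; unfold Rdiv in *; [lra|].
    field; lra. }
  split; [eexists; exact HI|].
  split; [apply is_RInt_gen_unique, HI|].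
  split; [eexists; exact HD|].
  rewrite (is_derive_unique _ _ _ HD); ring.
Qed.
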